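(* Let $K$ be a field, $A$ a $K$-algebra, $B$ a finite dimensional $K$-algebra with basis $\mathcal{B}=\{b_1,\dots,b_n\}$, structure constants $\lambda_{ij}^k$ ($b_ib_j=\sum_k\lambda_{ij}^k b_k$) and unit $1_B=\sum_j\alpha_jb_j$. Let $\chi\colon A\otimes B\to B\otimes A$ be a $K$-linear map and let $\gamma_i^j\colon A\to A$ ($1\le i,j\le n$) be the $K$-linear maps determined by $\chi(a\otimes b_i)=\sum_{j=1}^n b_j\otimes\gamma_i^j(a)$ for all $a\in A$. Let $E:=\operatorname{End}_K(A)$, let $\xi_{\mathcal{B}'}\colon B^{\mathrm{op}}\otimes E\to E^n$ be the right $E$-linear bijection with $\xi_{\mathcal{B}'}(b_k^{\mathrm{op}}\otimes 1)=e_k$, where $\{e_1,\dots,e_n\}$ is the canonical basis of $E^n$, and let $\rho_\chi\colon B^{\mathrm{op}}\to B^{\mathrm{op}}\otimes E$ be the $K$-linear map with $\rho_\chi(b_k^{\mathrm{op}})=\sum_{j} b_j^{\mathrm{op}}\otimes\gamma_k^j$. Then the following two conditions both hold: (3) $\alpha_k\,\mathrm{id}_A=\sum_i\alpha_i\gamma_i^k$ for all $k$, and (4) $\sum_k\lambda_{ij}^k\,\gamma_k^m=\sum_k\sum_l\lambda_{kl}^m\,\gamma_j^l\circ\gamma_i^k$ for all $i,j,m$, if and only if the map $$\dddot{\rho}_{\chi}\colon B^{\mathrm{op}}\to\operatorname{End}(E^n)_E,\qquad b^{\mathrm{op}}\mapsto \xi_{\mathcal{B}'}\circ l^E(\rho_\chi(b^{\mathrm{op}}))\circ\xi_{\mathcal{B}'}^{-1},$$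 is a representation of $B^{\mathrm{op}}$ or, equivalently, if and only if the map $\hat\rho_\chi\colon B^{\mathrm{op}}\to M_n(E)$, sending $b^{\mathrm{op}}$ to the matrix of $\dddot{\rho}_\chi(b^{\mathrm{op}})$ with respect to the canonical basis of $E^n$, is a matrix representation.
   Context: Algebras are associative and unital, algebra morphisms are unital, all maps are $K$-linear, and $\otimes=\otimes_K$. A representation (resp. matrix representation) is a (unital) algebra morphism into the indicated endomorphism (resp. matrix) algebra. $B^{\mathrm{op}}$ is the opposite algebra of $B$, and $b^{\mathrm{op}}$ denotes $b\in B$ viewed in $B^{\mathrm{op}}$. The product of $E=\operatorname{End}_K(A)$ is composition. For a right $E$-module $X$, $\operatorname{End}(X)_E$ denotes the algebra of right $E$-linear endomorphisms. The map $l^E\colon B^{\mathrm{op}}\otimes E\to\operatorname{End}_K(B^{\mathrm{op}}\otimes E)_E$ is the left regular representation, $l^E(c)(d)=cd$. The matrix of a right $E$-linear endomorphism $T$ of $E^n$ is $(t_{ij})$ with $T(e_j)=\sum_i e_it_{ij}$. *)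

(* Defs.v *)
From HB Require Import structures.
From mathcomp Require Import all_boot all_order all_algebra.
From mathcomp Require Import boolp.

Set Implicit Arguments.
Unset Strict Implicit.
Unset Printing Implicit Defensive.

Import GRing.Theory.
Local Open Scope ring_scope.
Local Open Scope quotient_scope.

(* B^op is the library's converse ring B^c, with the K-space structure of B. *)
Section Opposite.
Variable K : fieldType.

HB.instance Definition _ (V : lmodType K) := GRing.Lmodule.on V^c.

Variable B : algType K.

Fact op_scalerAl (k : K) (x y : B^c) : k *: (x * y) = (k *: x : B^c) * y.
Proof. exact: (@scalerAr K B k y x). Qed.

HB.instance Definition _ := GRing.Lmodule_isLalgebra.Build K B^c op_scalerAl.

Fact op_scalerAr (k : K) (x y : B^c) : k *: (x * y) = x * (k *: y : B^c).
Proof. exact: (@scalerAl K B k y x). Qed.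

HB.instance Definition _ := GRing.Lalgebra_isAlgebra.Build K B^c op_scalerAr.
End Opposite.

Definition op (K : fieldType) (B : algType K) (b : B) : B^c := b.

(* U ⊗ V: formal sums of pairs, two of them being identified when all
   bilinear maps agree on them; tens_lift_pure and tens_lift_uniq below give
   the universal property. *)
Section Tensor.
Variables (K : fieldType) (U V : lmodType K).

Definition fsum (W : lmodType K) (f : U -> V -> W) (s : seq (U * V)) : W :=
  \sum_(p <- s) f p.1 p.2.

Definition tens_eqv : rel (seq (U * V)) := fun s t =>
  `[< forall (W : lmodType K) (f : U -> V -> W),
        bilinear_for *:%R *:%R f -> fsum f s = fsum f t >].

Fact tens_eqv_refl : reflexive tens_eqv.
Proof. by move=> s; apply/asboolP. Qed.

Fact tens_eqv_sym : symmetric tens_eqv.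
Proof.
by move=> s t; apply: asbool_equiv_eq; split=> st W f /st.
Qed.

Fact tens_eqv_trans : transitive tens_eqv.
Proof.
move=> t s r /asboolP st /asboolP tr; apply/asboolP=> W f bf.
by rewrite st ?tr.
Qed.

Canonical tens_equiv : equiv_rel (seq (U * V)) :=
  EquivRel tens_eqv tens_eqv_refl tens_eqv_sym tens_eqv_trans.

Definition tensor : Type := {eq_quot tens_equiv}.
HB.instance Definition _ := Choice.on tensor.
HB.instance Definition _ := EqQuotient.on tensor.

Definition pure (u : U) (v : V) : tensor := \pi_tensor [:: (u, v)].

Definition tens_lift (W : lmodType K) (f : U -> V -> W) (t : tensor) : W :=
  fsum f (repr t).

Lemma tens_lift_pi (W : lmodType K) (f : U -> V -> W) s :
  bilinear_for *:%R *:%R f -> tens_lift f (\pi_tensor s) = fsum f s.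
Proof.
move=> bf; have /eqmodP/asboolP : repr (\pi_tensor s) = s %[mod tensor].
  by rewrite reprK.
exact.
Qed.

Lemma tensP (s t : tensor) :
  (forall (W : lmodType K) (f : U -> V -> W), bilinear_for *:%R *:%R f ->
     tens_lift f s = tens_lift f t) -> s = t.
Proof.
rewrite -[s]reprK -[t]reprK => st; apply/eqmodP/asboolP=> W f bf.
by have := st W f bf; rewrite !tens_lift_pi.
Qed.

Definition tens_add (s t : tensor) : tensor := \pi_tensor (repr s ++ repr t).
Definition tens_zero : tensor := \pi_tensor [::].
Definition tens_scale (k : K) (s : tensor) : tensor :=
  \pi_tensor [seq (k *: p.1, p.2) | p <- repr s].
Definition tens_opp (s : tensor) : tensor := tens_scale (-1) s.

Section Lift.
Variables (W : lmodType K) (f : U -> V -> W).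
Hypothesis bf : bilinear_for *:%R *:%R f.

Lemma tens_lift_add s t :
  tens_lift f (tens_add s t) = tens_lift f s + tens_lift f t.
Proof. by rewrite tens_lift_pi // /fsum big_cat. Qed.

Lemma tens_lift_zero : tens_lift f tens_zero = 0.
Proof. by rewrite tens_lift_pi // /fsum big_nil. Qed.

Lemma tens_lift_scale k s : tens_lift f (tens_scale k s) = k *: tens_lift f s.
Proof.
rewrite tens_lift_pi // /fsum big_map scaler_sumr; apply: eq_bigr => p _ /=.
exact: (scalable_linear (bf.1 p.2) k p.1).
Qed.
End Lift.

Fact tens_addA : associative tens_add.
Proof. by move=> r s t; apply: tensP => W f bf; rewrite !tens_lift_add // addrA. Qed.
Fact tens_addC : commutative tens_add.
Proof. by move=> s t; apply: tensP => W f bf; rewrite !tens_lift_add // addrC. Qed.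
Fact tens_add0 : left_id tens_zero tens_add.
Proof.
by move=> s; apply: tensP => W f bf; rewrite !(tens_lift_add, tens_lift_zero) // add0r.
Qed.
Fact tens_addN : left_inverse tens_zero tens_opp tens_add.
Proof.
move=> s; apply: tensP => W f bf.
by rewrite tens_lift_add // tens_lift_zero // tens_lift_scale // scaleN1r addNr.
Qed.

HB.instance Definition _ :=
  GRing.isZmodule.Build tensor tens_addA tens_addC tens_add0 tens_addN.

Fact tens_scaleA a b s : tens_scale a (tens_scale b s) = tens_scale (a * b) s.
Proof.
by apply: tensP => W f bf; rewrite !tens_lift_scale // scalerA.
Qed.
Fact tens_scale1 : left_id 1 tens_scale.
Proof. by move=> s; apply: tensP => W f bf; rewrite tens_lift_scale // scale1r. Qed.
Fact tens_scaleDr : right_distributive tens_scale +%R.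
Proof.
move=> a s t; apply: tensP => W f bf.
by rewrite !(tens_lift_scale, tens_lift_add) // scalerDr.
Qed.
Fact tens_scaleDl s : {morph tens_scale^~ s : a b / a + b}.
Proof.
move=> a b; apply: tensP => W f bf.
by rewrite !(tens_lift_scale, tens_lift_add) // scalerDl.
Qed.

HB.instance Definition _ := GRing.Zmodule_isLmodule.Build K tensor
  tens_scaleA tens_scale1 tens_scaleDr tens_scaleDl.

Lemma tens_lift_is_linear (W : lmodType K) (f : U -> V -> W) :
  bilinear_for *:%R *:%R f -> linear (tens_lift f).
Proof.
move=> bf k s t.
by rewrite -(tens_lift_scale bf) -(tens_lift_add bf).
Qed.

Lemma tens_lift_pure (W : lmodType K) (f : U -> V -> W) u v :
  bilinear_for *:%R *:%R f -> tens_lift f (pure u v) = f u v.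
Proof. by move=> bf; rewrite tens_lift_pi // /fsum big_seq1. Qed.

Lemma pure_is_bilinear : bilinear_for *:%R *:%R pure.
Proof.
split=> [v k u u' | u k v v']; apply: tensP => W f bf;
  rewrite tens_lift_is_linear // !tens_lift_pure //.
  exact: bf.1.
exact: bf.2.
Qed.

Lemma tensE (t : tensor) : t = \sum_(p <- repr t) pure p.1 p.2.
Proof.
apply: tensP => W f bf.
have -> : tens_lift f (\sum_(p <- repr t) pure p.1 p.2) =
          \sum_(p <- repr t) tens_lift f (pure p.1 p.2).
  apply: big_morph => [x y|]; first exact: (tens_lift_add bf).
  exact: tens_lift_zero.
by apply: eq_bigr => p _; rewrite tens_lift_pure.
Qed.

Lemma tens_lift_uniq (W : lmodType K) (f : U -> V -> W)
    (g : {linear tensor -> W}) :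
  (forall u v, g (pure u v) = f u v) -> g =1 tens_lift f.
Proof.
move=> gf t; rewrite [in LHS](tensE t) linear_sum.
by apply: eq_bigr => p _; rewrite gf.
Qed.
End Tensor.

Notation "u ⊗ v" := (pure u v) (at level 40, no associativity) : ring_scope.

Section TensorAlgebra.
Variables (K : fieldType) (U V : algType K).
Implicit Types s t : tensor U V.

Definition tens_one : tensor U V := 1 ⊗ 1.
Definition tens_mul s t : tensor U V :=
  tens_lift (fun u v => tens_lift (fun u' v' => (u * u') ⊗ (v * v')) t) s.

Lemma tens_mul_bil_r (u : U) (v : V) :
  bilinear_for *:%R *:%R (fun u' v' => (u * u') ⊗ (v * v')).
Proof.
split=> [v' k x y | u' k x y] /=; rewrite mulrDr -scalerAr.
  exact: (pure_is_bilinear U V).1.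
exact: (pure_is_bilinear U V).2.
Qed.

Lemma tens_mul_bil_l t :
  bilinear_for *:%R *:%R
    (fun u v => tens_lift (fun u' v' => (u * u') ⊗ (v * v')) t).
Proof.
split=> [v k x y | u k x y]; rewrite /tens_lift /fsum /= scaler_sumr -big_split;
  apply: eq_bigr => p _ /=; rewrite mulrDl -scalerAl.
  exact: (pure_is_bilinear U V).1.
exact: (pure_is_bilinear U V).2.
Qed.

Lemma tens_mul_pure (u u' : U) (v v' : V) :
  tens_mul (u ⊗ v) (u' ⊗ v') = (u * u') ⊗ (v * v').
Proof.
rewrite /tens_mul tens_lift_pure; last exact: tens_mul_bil_l.
by rewrite tens_lift_pure //; apply: tens_mul_bil_r.
Qed.

Fact tens_mulDl : left_distributive tens_mul +%R.
Proof.
by move=> x y t; apply: (tens_lift_add (tens_mul_bil_l t)).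
Qed.

Fact tens_mulZl k s t : tens_mul (k *: s) t = k *: tens_mul s t.
Proof. exact: (tens_lift_scale (tens_mul_bil_l t)). Qed.

Lemma tens_mul_sumr t s :
  tens_mul s t = \sum_(p <- repr s)
    tens_lift (fun u' v' => (p.1 * u') ⊗ (p.2 * v')) t.
Proof. by []. Qed.

Fact tens_mulDr : right_distributive tens_mul +%R.
Proof.
move=> s x y; rewrite !tens_mul_sumr -big_split; apply: eq_bigr => p _.
exact: (tens_lift_add (tens_mul_bil_r p.1 p.2)).
Qed.

Fact tens_mulZr k s t : tens_mul s (k *: t) = k *: tens_mul s t.
Proof.
rewrite !tens_mul_sumr scaler_sumr; apply: eq_bigr => p _.
exact: (tens_lift_scale (tens_mul_bil_r p.1 p.2)).
Qed.

Lemma tens_ind (P : tensor U V -> Prop) :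
  P 0 -> (forall s t, P s -> P t -> P (s + t)) ->
  (forall u v, P (u ⊗ v)) -> forall t, P t.
Proof.
move=> P0 PD Pp t; rewrite (tensE t).
by apply: big_ind => // p _; apply: Pp.
Qed.

Lemma tens_mul0l t : tens_mul 0 t = 0.
Proof. by rewrite -[X in tens_mul X t](scale0r 0) tens_mulZl scale0r. Qed.
Lemma tens_mul0r t : tens_mul t 0 = 0.
Proof. by rewrite -[X in tens_mul t X](scale0r 0) tens_mulZr scale0r. Qed.

Fact tens_mul1l : left_id tens_one tens_mul.
Proof.
elim/tens_ind => [|s t hs ht|u v]; first exact: tens_mul0r.
  by rewrite tens_mulDr hs ht.
by rewrite tens_mul_pure !mul1r.
Qed.

Fact tens_mul1r : right_id tens_one tens_mul.
Proof.
elim/tens_ind => [|s t hs ht|u v]; first exact: tens_mul0l.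
  by rewrite tens_mulDl hs ht.
by rewrite tens_mul_pure !mulr1.
Qed.

Fact tens_mulA : associative tens_mul.
Proof.
move=> r s t; elim/tens_ind: r => [|r r' hr hr'|u v].
- by rewrite !tens_mul0l.
- by rewrite !tens_mulDl hr hr'.
elim/tens_ind: s => [|s s' hs hs'|u' v'].
- by rewrite !(tens_mul0l, tens_mul0r).
- by rewrite !(tens_mulDl, tens_mulDr) hs hs'.
elim/tens_ind: t => [|t t' ht ht'|u'' v''].
- by rewrite !tens_mul0r.
- by rewrite !tens_mulDr ht ht'.
by rewrite !tens_mul_pure !mulrA.
Qed.

HB.instance Definition _ := GRing.Zmodule_isPzRing.Build (tensor U V)
  tens_mulA tens_mul1l tens_mul1r tens_mulDl tens_mulDr.

Lemma pureM (u u' : U) (v v' : V) :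
  (u ⊗ v) * (u' ⊗ v') = (u * u') ⊗ (v * v').
Proof. exact: tens_mul_pure. Qed.

Lemma tens_scalerAl (k : K) s t : k *: (s * t) = (k *: s) * t.
Proof. by rewrite [RHS]tens_mulZl. Qed.

Lemma tens_scalerAr (k : K) s t : k *: (s * t) = s * (k *: t).
Proof. by rewrite [RHS]tens_mulZr. Qed.
End TensorAlgebra.

Section EndRing.
Variables (R : pzRingType) (V : lmodType R).

Definition linEnd : Type := {linear V -> V}.

HB.instance Definition _ := gen_eqMixin linEnd.
HB.instance Definition _ := gen_choiceMixin linEnd.

Implicit Types f g h : linEnd.

Lemma linEndP f g : f =1 g -> f = g.
Proof.
case: f g => [f [[a1] [b1]]] [g [[a2] [b2]]] /= fg.
have E : f = g by apply/funext.
case: g / E a2 b2 {fg} => a2 b2.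
by rewrite (Prop_irrelevance a1 a2) (Prop_irrelevance b1 b2).
Qed.

Definition linEnd_add f g : linEnd := f \+ g.
Definition linEnd_opp f : linEnd := \- f.
Definition linEnd_zero : linEnd := \0.
Definition linEnd_one : linEnd := idfun.
Definition linEnd_mul f g : linEnd := f \o g.

Fact linEnd_addA : associative linEnd_add.
Proof. by move=> f g h; apply: linEndP => x /=; rewrite addrA. Qed.
Fact linEnd_addC : commutative linEnd_add.
Proof. by move=> f g; apply: linEndP => x /=; rewrite addrC. Qed.
Fact linEnd_add0 : left_id linEnd_zero linEnd_add.
Proof. by move=> f; apply: linEndP => x /=; rewrite add0r. Qed.
Fact linEnd_addN : left_inverse linEnd_zero linEnd_opp linEnd_add.
Proof. by move=> f; apply: linEndP => x /=; rewrite addNr. Qed.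

HB.instance Definition _ := GRing.isZmodule.Build linEnd
  linEnd_addA linEnd_addC linEnd_add0 linEnd_addN.

Fact linEnd_mulA : associative linEnd_mul.
Proof. by move=> f g h; apply: linEndP. Qed.
Fact linEnd_mul1l : left_id linEnd_one linEnd_mul.
Proof. by move=> f; apply: linEndP. Qed.
Fact linEnd_mul1r : right_id linEnd_one linEnd_mul.
Proof. by move=> f; apply: linEndP. Qed.
Fact linEnd_mulDl : left_distributive linEnd_mul +%R.
Proof. by move=> f g h; apply: linEndP. Qed.
Fact linEnd_mulDr : right_distributive linEnd_mul +%R.
Proof. by move=> f g h; apply: linEndP => x; apply: linearD. Qed.

HB.instance Definition _ := GRing.Zmodule_isPzRing.Build linEnd
  linEnd_mulA linEnd_mul1l linEnd_mul1r linEnd_mulDl linEnd_mulDr.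

Lemma linEnd0E x : (0 : linEnd) x = 0. Proof. by []. Qed.
Lemma linEndDE f g x : (f + g) x = f x + g x. Proof. by []. Qed.
Lemma linEnd1E x : (1 : linEnd) x = x. Proof. by []. Qed.
Lemma linEndME f g x : (f * g) x = f (g x). Proof. by []. Qed.
End EndRing.

Section EndK.
Variables (K : fieldType) (V : lmodType K).

Definition endK : Type := linEnd V.
HB.instance Definition _ := GRing.PzRing.on endK.

Implicit Types f g : endK.

Definition endK_scale (k : K) f : endK := k \*: f.

Fact endK_scaleA a b f : endK_scale a (endK_scale b f) = endK_scale (a * b) f.
Proof. by apply: linEndP => x /=; rewrite scalerA. Qed.
Fact endK_scale1 : left_id 1 endK_scale.
Proof. by move=> f; apply: linEndP => x /=; rewrite scale1r. Qed.
Fact endK_scaleDr : right_distributive endK_scale +%R.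
Proof. by move=> a f g; apply: linEndP => x /=; rewrite scalerDr. Qed.
Fact endK_scaleDl f : {morph endK_scale^~ f : a b / a + b}.
Proof. by move=> a b; apply: linEndP => x /=; rewrite scalerDl. Qed.

HB.instance Definition _ := GRing.Zmodule_isLmodule.Build K endK
  endK_scaleA endK_scale1 endK_scaleDr endK_scaleDl.

Lemma endKZE k f x : (k *: f) x = k *: f x. Proof. by []. Qed.
End EndK.

Section EndKAlgebra.
Variables (K : fieldType) (A : algType K).

Fact endK_oner_neq0 : (1 : endK A) != 0.
Proof.
apply/eqP => /(congr1 (fun f : endK A => f (1 : A))) /eqP.
by rewrite linEnd1E linEnd0E oner_eq0.
Qed.
HB.instance Definition _ := GRing.PzSemiRing_isNonZero.Build (endK A) endK_oner_neq0.

Fact endK_scalerAl (k : K) (f g : endK A) : k *: (f * g) = (k *: f : endK A) * g.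
Proof. by apply: linEndP => x. Qed.
HB.instance Definition _ := GRing.Lmodule_isLalgebra.Build K (endK A) endK_scalerAl.

Fact endK_scalerAr (k : K) (f g : endK A) : k *: (f * g) = f * (k *: g : endK A).
Proof. by apply: linEndP => x; rewrite endKZE !linEndME linearZ. Qed.
HB.instance Definition _ := GRing.Lalgebra_isAlgebra.Build K (endK A) endK_scalerAr.
End EndKAlgebra.

(* Right E-modules are the left modules over the converse ring E^c, so that
   x . e is written e *: x.  In particular (E^c)^o is E acting on itself by
   right multiplication, and End(X)_E consists of the E^c-linear maps. *)
Section RightModules.
Variables (K : fieldType) (E : algType K).

Definition rfree (n : nat) : Type := {ffun 'I_n -> (E^c)^o}.
HB.instance Definition _ n := GRing.Lmodule.on (rfree n).

Definition rbasis n (j : 'I_n) : rfree n := [ffun i => (i == j)%:R].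

Lemma rfree_actE n (e : E) (x : rfree n) i : ((e : E^c) *: x) i = (x i : E) * e.
Proof. by rewrite ffunE. Qed.

Variable X : lmodType E^c.

Definition rEnd : Type := linEnd X.
HB.instance Definition _ := GRing.PzRing.on rEnd.

Fact rEnd_scale_subproof (k : K) (T : rEnd) :
  linear (fun x : X => (k%:A : E^c) *: T x).
Proof.
move=> e x y; rewrite linearP scalerDr !scalerA; congr (_ *: _ + _).
by rewrite /GRing.mul /= -scalerAr mulr1 -scalerAl mul1r.
Qed.

Definition rEnd_scale (k : K) (T : rEnd) : rEnd :=
  HB.pack_for {linear X -> X} (fun x : X => (k%:A : E^c) *: T x)
    (GRing.isLinear.Build E^c X X *:%R _ (rEnd_scale_subproof k T)).

Fact rEnd_scaleA a b T : rEnd_scale a (rEnd_scale b T) = rEnd_scale (a * b) T.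
Proof.
apply: linEndP => x /=; rewrite scalerA; congr (_ *: _).
by rewrite /GRing.mul /= -scalerAl mul1r scalerA mulrC.
Qed.
Fact rEnd_scale1 : left_id 1 rEnd_scale.
Proof. by move=> T; apply: linEndP => x /=; rewrite !scale1r. Qed.
Fact rEnd_scaleDr : right_distributive rEnd_scale +%R.
Proof. by move=> k S T; apply: linEndP => x /=; rewrite scalerDr. Qed.
Fact rEnd_scaleDl T : {morph rEnd_scale^~ T : a b / a + b}.
Proof. by move=> a b; apply: linEndP => x /=; rewrite scalerDl scalerDl. Qed.

HB.instance Definition _ := GRing.Zmodule_isLmodule.Build K rEnd
  rEnd_scaleA rEnd_scale1 rEnd_scaleDr rEnd_scaleDl.
End RightModules.

(* B ⊗ E as a right E-module, (b ⊗ f) . e = b ⊗ f e. *)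
Section RightTensor.
Variables (K : fieldType) (B E : algType K).

Definition rtensor : Type := tensor B E.
HB.instance Definition _ := GRing.PzRing.on rtensor.

Definition rtensor_act (e : E^c) (t : rtensor) : rtensor := t * (1 ⊗ (e : E)).

Fact rtensor_actA a b t :
  rtensor_act a (rtensor_act b t) = rtensor_act (a * b) t.
Proof. by rewrite /rtensor_act -mulrA [X in t * X]pureM mulr1. Qed.
Fact rtensor_act1 : left_id 1 rtensor_act.
Proof. by move=> t; apply: mulr1. Qed.
Fact rtensor_actDr : right_distributive rtensor_act +%R.
Proof. by move=> a s t; apply: mulrDl. Qed.
Fact rtensor_actDl t : {morph rtensor_act^~ t : a b / a + b}.
Proof.
move=> a b; rewrite /rtensor_act -mulrDr; congr (t * _).
by have /= := (pure_is_bilinear B E).2 1 1 a b; rewrite !scale1r => ->.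
Qed.

HB.instance Definition _ := GRing.Zmodule_isLmodule.Build E^c rtensor
  rtensor_actA rtensor_act1 rtensor_actDr rtensor_actDl.

Lemma rtensor_act_pure (b : B) (f e : E) :
  (e : E^c) *: (b ⊗ f : rtensor) = b ⊗ (f * e).
Proof. by rewrite /GRing.scale /= /rtensor_act [LHS]pureM mulr1. Qed.

Fact lreg_subproof (c : tensor B E) : linear (fun d : rtensor => c * d : rtensor).
Proof. by move=> e x y; rewrite [LHS]mulrDr [X in X + _]mulrA. Qed.

Definition lreg (c : tensor B E) : rEnd rtensor :=
  HB.pack_for {linear rtensor -> rtensor} (fun d : rtensor => c * d : rtensor)
    (GRing.isLinear.Build E^c rtensor rtensor *:%R _ (lreg_subproof c)).

Lemma lregE (c : tensor B E) (d : rtensor) : lreg c d = c * d.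
Proof. by []. Qed.
End RightTensor.

Definition rconj (K : fieldType) (E : algType K) (X Y : lmodType E^c)
    (f : {linear X -> Y}) (g : {linear Y -> X}) (T : rEnd X) : rEnd Y :=
  f \o T \o g.

(* M_n(E) as a K-algebra; the library's scaling of matrices is over E. *)
Section MatrixAlgebra.
Variables (K : fieldType) (E : algType K) (n : nat).

Definition mxalg : Type := 'M[E]_n.
HB.instance Definition _ := GRing.PzRing.on mxalg.

Definition mxalg_scale (k : K) (M : mxalg) : mxalg := map_mx ( *:%R k) M.

Fact mxalg_scaleA a b M : mxalg_scale a (mxalg_scale b M) = mxalg_scale (a * b) M.
Proof. by apply/matrixP => i j; rewrite !mxE scalerA. Qed.
Fact mxalg_scale1 : left_id 1 mxalg_scale.
Proof. by move=> M; apply/matrixP => i j; rewrite !mxE scale1r. Qed.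
Fact mxalg_scaleDr : right_distributive mxalg_scale +%R.
Proof. by move=> a M N; apply/matrixP => i j; rewrite !mxE scalerDr. Qed.
Fact mxalg_scaleDl M : {morph mxalg_scale^~ M : a b / a + b}.
Proof. by move=> a b; apply/matrixP => i j; rewrite !mxE scalerDl. Qed.

HB.instance Definition _ := GRing.Zmodule_isLmodule.Build K mxalg
  mxalg_scaleA mxalg_scale1 mxalg_scaleDr mxalg_scaleDl.

Definition mx_of_rEnd (T : rEnd (rfree E n)) : mxalg :=
  \matrix_(i, j) (T (rbasis E j) i : E).

Lemma mx_of_rEndE (T : rEnd (rfree E n)) (j : 'I_n) :
  T (rbasis E j) = \sum_i (mx_of_rEnd T i j : E^c) *: rbasis E i.
Proof.
apply/ffunP => i; rewrite sum_ffunE (bigD1 i) //= big1 => [|k kNi].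
  by rewrite rfree_actE mxE ffunE eqxx mul1r addr0.
by rewrite rfree_actE ffunE eq_sym (negPf kNi) mul0r.
Qed.
End MatrixAlgebra.

Section Rho.
Variables (K : fieldType) (B E : algType K) (n : nat).
Variables (xi : {linear rtensor B^c E -> rfree E n}).
Variables (xi_inv : {linear rfree E n -> rtensor B^c E}).
Variables (rho : B^c -> tensor B^c E).

Definition rho_ddd (x : B^c) : rEnd (rfree E n) := rconj xi xi_inv (lreg (rho x)).

Definition rho_hat (x : B^c) : mxalg E n := mx_of_rEnd (rho_ddd x).
End Rho.

(* Main.v *)
Require Import Defs.
From HB Require Import structures.
From mathcomp Require Import all_boot all_order all_algebra all_field.

Set Implicit Arguments.
Unset Strict Implicit.
Unset Printing Implicit Defensive.

Import GRing.Theory.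
Local Open Scope ring_scope.

(** Neither the passage to endomorphisms of E^n nor the passage to matrices
    carries information of its own: the left regular representation is
    injective (evaluate at 1), multiplicative and K-linear, conjugation by the
    bijection xi keeps these properties, and so does taking the matrix of a
    right E-linear endomorphism of E^n. Composing a linear map with an
    injective algebra morphism neither creates nor destroys the property of
    being a representation, so both equivalences reduce to one question: when
    is rho : B^op -> B^op ⊗ E multiplicative and unital?

    That question is settled by comparing coefficients. Since xi maps
    b_k^op ⊗ 1 to e_k, a tensor written as a sum of b_m^op ⊗ f_m determines
    its coefficients f_m in E ([sum_pure_inj]). The two sides of rho 1 = 1 have
    m-th coefficients sum_i alpha_i gamma_i^m and alpha_m id, which gives
    condition (3) ([rho_one]). Multiplicativity need only be tested on the
    basis ([linear_morph_span]); there b_j^op b_i^op = (b_i b_j)^op, and the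
    m-th coefficients of rho (b_j^op b_i^op) and rho b_j^op rho b_i^op are the
    two sides of condition (4) at (i, j, m) ([rho_mul]). The opposite algebra
    is what puts gamma_j^l to the left of gamma_i^k while the structure
    constant stays lam_kl^m. *)

(** This transfers the question along l^E, along conjugation by xi, and along
    the passage to matrices. *)
Lemma monoid_morphism_inj_comp (R S T : pzRingType) (f : R -> S) (g : S -> T) :
  injective g -> GRing.monoid_morphism g ->
  GRing.monoid_morphism (fun x => g (f x)) <-> GRing.monoid_morphism f.
Proof.
move=> ginj [g1 gM]; split=> [[h1 hM]|[f1 fM]]; split=> [|x y].
- by apply: ginj; rewrite g1.
- by apply: ginj; rewrite hM gM.
- by rewrite f1.
- by rewrite fM gM.
Qed.

Lemma pureZl (K : fieldType) (U V : lmodType K) (k : K) (u : U) (v : V) :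
  (k *: u) ⊗ v = k *: (u ⊗ v).
Proof. exact: (scalable_linear ((pure_is_bilinear U V).1 v) k u). Qed.

Lemma pureZr (K : fieldType) (U V : lmodType K) (k : K) (u : U) (v : V) :
  u ⊗ (k *: v) = k *: (u ⊗ v).
Proof. exact: (scalable_linear ((pure_is_bilinear U V).2 u) k v). Qed.

Lemma pure_sumr (K : fieldType) (U V : lmodType K) (I : finType) (u : U)
  (f : I -> V) : u ⊗ (\sum_i f i) = \sum_i (u ⊗ f i).
Proof.
apply: (big_morph (fun v => u ⊗ v)) => [v w|].
  by have /= := (pure_is_bilinear U V).2 u 1 v w; rewrite !scale1r.
by rewrite -[X in u ⊗ X](scale0r 0) pureZr scale0r.
Qed.

Lemma pure_suml (K : fieldType) (U V : lmodType K) (I : finType) (f : I -> U)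
  (v : V) : (\sum_i f i) ⊗ v = \sum_i (f i ⊗ v).
Proof.
apply: (big_morph (fun u => u ⊗ v)) => [u w|].
  by have /= := (pure_is_bilinear U V).1 v 1 u w; rewrite !scale1r.
by rewrite -[X in X ⊗ v](scale0r 0) pureZl scale0r.
Qed.

Section Matrices.
Variables (K : fieldType) (E : algType K) (n : nat).

Lemma rfree_sum_basis (x : rfree E n) : x = \sum_i (x i : E^c) *: rbasis E i.
Proof.
apply/ffunP => i; rewrite sum_ffunE (bigD1 i) //= big1 => [|k kNi].
  by rewrite rfree_actE ffunE eqxx mul1r addr0.
by rewrite rfree_actE ffunE eq_sym (negPf kNi) mul0r.
Qed.

(** An endomorphism is recovered from the columns of its matrix because the
    canonical basis spans E^n as a right module. *)
Lemma mx_of_rEnd_inj : injective (@mx_of_rEnd K E n).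
Proof.
move=> S T ST; apply: linEndP => x; rewrite (rfree_sum_basis x) !linear_sum.
by apply: eq_bigr => i _; rewrite !linearZ /= !mx_of_rEndE ST.
Qed.

Lemma mx_of_rEnd_linear : linear (@mx_of_rEnd K E n).
Proof.
move=> k S T; apply/matrixP => i j; rewrite !mxE linEndDE ffunE.
by congr (_ + _); rewrite /= rfree_actE -scalerAr mulr1.
Qed.

(** The scalars act on the right of E^n, hence on the right of the coordinates
    of T (e_k), which makes composition correspond to the matrix product over E
    itself and not over its opposite. *)
Lemma mx_of_rEnd_monoid : GRing.monoid_morphism (@mx_of_rEnd K E n).
Proof.
split=> [|S T]; apply/matrixP => i j; first by rewrite !mxE linEnd1E ffunE.
rewrite !mxE linEndME mx_of_rEndE linear_sum sum_ffunE.
by apply: eq_bigr => k _; rewrite linearZ /= rfree_actE !mxE.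
Qed.
End Matrices.

Section ConjugatedRegular.
Variables (K : fieldType) (B E : algType K) (Y : lmodType E^c).
Variables (xi : {linear rtensor B E -> Y}) (xi_inv : {linear Y -> rtensor B E}).
Hypotheses (xiK : cancel xi xi_inv) (xi_invK : cancel xi_inv xi).

(** The scalar k acts on endomorphisms through the right action of k 1_E, which
    on B ⊗ E is right multiplication by 1 ⊗ k 1_E = k (1 ⊗ 1). *)
Lemma rconj_lreg_linear : linear (fun c => rconj xi xi_inv (lreg c)).
Proof.
move=> k c d; apply: linEndP => y; rewrite linEndDE /=.
rewrite -linearZ -linearD /=; congr (xi _).
rewrite mulrDl; congr (_ + _).
rewrite -tens_scalerAl /GRing.scale /= /rtensor_act.
have -> : (1 : B) ⊗ (k%:A : E) = k *: (1 : tensor B E).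
  exact: pureZr.
by rewrite -[RHS]tens_scalerAr mulr1.
Qed.

Lemma rconj_lreg_monoid :
  GRing.monoid_morphism (fun c => rconj xi xi_inv (lreg c)).
Proof.
split=> [|c d]; apply: linEndP => y; first by rewrite /= mul1r xi_invK.
by rewrite linEndME /= xiK mulrA.
Qed.

(** An element c is recovered as the value of l^E(c) at 1. *)
Lemma rconj_lreg_inj : injective (fun c => rconj xi xi_inv (lreg c)).
Proof.
move=> c d /(congr1 (fun T : rEnd Y => xi_inv (T (xi 1)))) /=.
by rewrite !xiK => cd; rewrite -[c]mulr1 -[d]mulr1.
Qed.
End ConjugatedRegular.

Section Coefficients.
Variables (K : fieldType) (B E : algType K) (n : nat) (c : 'I_n -> B).
Variable xi : {linear rtensor B E -> rfree E n}.
Hypothesis xi_c : forall k, xi (c k ⊗ 1) = rbasis E k.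

(** By right linearity, c_k ⊗ f_k = (c_k ⊗ 1) . f_k goes to e_k . f_k. *)
Lemma xi_sum_pure (f : 'I_n -> E) m : xi (\sum_k c k ⊗ f k) m = f m.
Proof.
have -> : \sum_k c k ⊗ f k = \sum_k (f k : E^c) *: (c k ⊗ 1 : rtensor B E).
  by apply: eq_bigr => k _; rewrite rtensor_act_pure mul1r.
rewrite linear_sum sum_ffunE (bigD1 m) //= big1 => [|k kNm].
  by rewrite linearZ /= xi_c rfree_actE ffunE eqxx mul1r addr0.
by rewrite linearZ /= xi_c rfree_actE ffunE eq_sym (negPf kNm) mul0r.
Qed.

(** This is the freeness of B ⊗ E over E, read off from xi, and it is what
    turns identities in B ⊗ E into systems of identities in E. *)
Lemma sum_pure_inj (f g : 'I_n -> E) :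
  \sum_k c k ⊗ f k = \sum_k c k ⊗ g k :> tensor B E <-> f =1 g.
Proof.
split=> [fg m|fg]; last by apply: eq_bigr => k _; rewrite fg.
by rewrite -(xi_sum_pure f) fg xi_sum_pure.
Qed.
End Coefficients.

(** Both x y |-> rho (x y) and x y |-> rho x * rho y are bilinear. *)
Lemma linear_morph_span (K : fieldType) (B C D : algType K) (n : nat)
    (b : 'I_n -> B) (rho : {linear B -> tensor C D}) :
  (forall x, exists a : 'I_n -> K, x = \sum_i a i *: b i) ->
  (forall i j, rho (b i * b j) = rho (b i) * rho (b j)) ->
  {morph rho : x y / x * y}.
Proof.
move=> b_span rhoM x y; have [u ->] := b_span x; have [v ->] := b_span y.
rewrite mulr_suml !linear_sum mulr_suml; apply: eq_bigr => i _.
rewrite mulr_sumr !linear_sum mulr_sumr; apply: eq_bigr => j _.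
rewrite -scalerAl -scalerAr !linearZ /= rhoM.
by rewrite -tens_scalerAl -tens_scalerAr.
Qed.

Section StructureConstants.
Variables (K : fieldType) (B E : algType K) (n : nat) (b : 'I_n -> B).
Variables (lam : 'I_n -> 'I_n -> 'I_n -> K) (alpha : 'I_n -> K).
Hypothesis b_span : forall x, exists a : 'I_n -> K, x = \sum_i a i *: b i.
Hypothesis b_mul : forall i j, b i * b j = \sum_k lam i j k *: b k.
Hypothesis b_one : 1 = \sum_j alpha j *: b j.
Variable gamma : 'I_n -> 'I_n -> E.
Variable xi : {linear rtensor B^c E -> rfree E n}.
Hypothesis xi_b : forall k, xi (op (b k) ⊗ 1) = rbasis E k.
Variable rho : {linear B^c -> tensor B^c E}.
Hypothesis rho_b : forall k, rho (op (b k)) = \sum_j op (b j) ⊗ gamma k j.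

(** This covers rho of the unit (coefficients alpha) and of a product of two
    basis elements (coefficients lam i j). *)
Lemma rho_sum (a : 'I_n -> K) :
  rho (op (\sum_i a i *: b i)) =
  \sum_m op (b m) ⊗ (\sum_i a i *: gamma i m).
Proof.
rewrite [LHS](linear_sum rho).
under [RHS]eq_bigr do rewrite pure_sumr.
rewrite exchange_big; apply: eq_bigr => i _ /=.
have -> : rho (a i *: b i) = a i *: rho (op (b i)) by apply: linearZ.
by rewrite rho_b scaler_sumr; apply: eq_bigr => m _; rewrite pureZr.
Qed.

Lemma tens_one_coef : 1 = \sum_m op (b m) ⊗ (alpha m *: 1) :> tensor B^c E.
Proof.
have -> : 1 = op 1 ⊗ 1 :> tensor B^c E by [].
by rewrite b_one /op pure_suml; apply: eq_bigr => m _; rewrite pureZr -pureZl.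
Qed.

Lemma rho_one : rho 1 = 1 <->
  forall k, alpha k *: (1 : E) = \sum_i alpha i *: gamma i k.
Proof.
have -> : rho 1 = rho (op (\sum_i alpha i *: b i)) by rewrite -b_one.
rewrite rho_sum tens_one_coef (sum_pure_inj xi_b).
by split=> h k; rewrite h.
Qed.

(** The product (b_l^op ⊗ gamma_j^l) (b_k^op ⊗ gamma_i^k) has first factor
    (b_k b_l)^op, and expanding b_k b_l produces the coefficients lam_kl^m. *)
Lemma rho_mul_coef i j :
  rho (op (b j)) * rho (op (b i)) =
  \sum_m op (b m) ⊗ (\sum_k \sum_l lam k l m *: (gamma j l * gamma i k)).
Proof.
rewrite !rho_b mulr_suml.
under [RHS]eq_bigr do rewrite pure_sumr.
rewrite exchange_big /=.
under eq_bigr do rewrite mulr_sumr.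
rewrite exchange_big /=; apply: eq_bigr => k _.
under [RHS]eq_bigr do rewrite pure_sumr.
rewrite exchange_big /=; apply: eq_bigr => l _.
have -> : (op (b l) ⊗ gamma j l) * (op (b k) ⊗ gamma i k) =
          op (b k * b l) ⊗ (gamma j l * gamma i k) by rewrite pureM.
rewrite b_mul /op pure_suml; apply: eq_bigr => m _.
by rewrite pureZr -pureZl.
Qed.

(** The indices are exchanged between the two sides: condition (4) at (i, j)
    expresses multiplicativity at the pair (b_j^op, b_i^op). *)
Lemma rho_mul : {morph rho : x y / x * y} <->
  forall i j m, \sum_k lam i j k *: gamma k m =
                \sum_k \sum_l lam k l m *: (gamma j l * gamma i k).
Proof.
have rho_mulE i j : rho (op (b j) * op (b i)) = rho (op (b j)) * rho (op (b i))
    <-> forall m, \sum_k lam i j k *: gamma k m =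
                  \sum_k \sum_l lam k l m *: (gamma j l * gamma i k).
  have -> : op (b j) * op (b i) = op (\sum_k lam i j k *: b k) by rewrite -b_mul.
  by rewrite rho_sum rho_mul_coef (sum_pure_inj xi_b).
split=> [rhoM i j|h]; first by apply/rho_mulE; rewrite rhoM.
apply: (linear_morph_span (b := fun i => op (b i))); first exact: b_span.
by move=> j i; apply/rho_mulE.
Qed.
End StructureConstants.

Theorem corollary2p2 (K : fieldType) (A : algType K) (B : falgType K)
  (n : nat) (b : n.-tuple B) (hb : basis_of fullv b)
  (lam : 'I_n -> 'I_n -> 'I_n -> K)
  (hlam : forall i j, tnth b i * tnth b j = \sum_k lam i j k *: tnth b k)
  (alpha : 'I_n -> K) (halpha : 1 = \sum_j alpha j *: tnth b j)
  (chi : {linear tensor A B -> tensor B A})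
  (gamma : 'I_n -> 'I_n -> endK A)
  (hgamma : forall (a : A) (i : 'I_n),
    chi (a ⊗ tnth b i) = \sum_j tnth b j ⊗ gamma i j a)
  (xi : {linear rtensor B^c (endK A) -> rfree (endK A) n})
  (xi_inv : {linear rfree (endK A) n -> rtensor B^c (endK A)})
  (xiK : cancel xi xi_inv) (xi_invK : cancel xi_inv xi)
  (hxi : forall k, xi (op (tnth b k) ⊗ 1) = rbasis (endK A) k)
  (rho : {linear B^c -> tensor B^c (endK A)})
  (hrho : forall k, rho (op (tnth b k)) = \sum_j op (tnth b j) ⊗ gamma k j) :
  let cond3 := forall k, alpha k *: (1 : endK A) = \sum_i alpha i *: gamma i k in
  let cond4 := forall i j m,
    \sum_k lam i j k *: gamma k m =
    \sum_k \sum_l lam k l m *: (gamma j l * gamma i k) in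
  (cond3 /\ cond4 <->
    linear (rho_ddd xi xi_inv rho) /\
    GRing.monoid_morphism (rho_ddd xi xi_inv rho)) /\
  (cond3 /\ cond4 <->
    linear (rho_hat xi xi_inv rho) /\
    GRing.monoid_morphism (rho_hat xi xi_inv rho)).
Proof.
move=> cond3 cond4.
have b_span (x : B) : exists a : 'I_n -> K, x = \sum_i a i *: tnth b i.
  exists (fun i => coord b i x); rewrite [LHS](coord_basis hb (memvf x)).
  by apply: eq_bigr => i _; rewrite -tnth_nth.
have rho_morph : cond3 /\ cond4 <-> GRing.monoid_morphism rho.
  have one := rho_one halpha hxi hrho.
  have mul := rho_mul b_span hlam hxi hrho.
  by split=> [[/one ? /mul ?]|[/one ? /mul ?]].
have ddd_lin : linear (rho_ddd xi xi_inv rho).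
  by move=> k x y; rewrite -rconj_lreg_linear /rho_ddd linearP.
have ddd_morph := monoid_morphism_inj_comp rho (rconj_lreg_inj xiK)
  (rconj_lreg_monoid xiK xi_invK).
have hat_lin : linear (rho_hat xi xi_inv rho).
  by move=> k x y; rewrite -mx_of_rEnd_linear /rho_hat ddd_lin.
have hat_morph := monoid_morphism_inj_comp (rho_ddd xi xi_inv rho)
  (@mx_of_rEnd_inj _ _ _) (@mx_of_rEnd_monoid _ _ _).
split.
  by split=> [/rho_morph/ddd_morph|[_ /ddd_morph/rho_morph]].
by split=> [/rho_morph/ddd_morph/hat_morph|[_ /hat_morph/ddd_morph/rho_morph]].
Qed.
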